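(* Let $G=(V,E,\mathbf{w}_0)$ be a connected finite weighted graph with $E=\{e_1,\dots,e_m\}$ and initial weight $\mathbf{w}_0=(w_{0,e})_{e\in E}\in\mathbb{R}_+^m$. Then for any $\alpha\in(0,1)$, the local entropy flow $$\begin{cases} w_e'(t)=\Theta_e^\alpha(t), & t>0,\\ w_e(t)>0, & t>0,\\ w_e(0)=w_{0,e}, & \end{cases}\qquad \forall e\in E,$$ where $\Theta_e^\alpha(t)$ is the edge entropy of $e$ computed with respect to the weight vector $\mathbf{w}(t)=(w_e(t))_{e\in E}$, admits a unique global solution $\mathbf{w}(t)=(w_e(t))_{e\in E}\in\mathbb{R}_+^m$ for all $t\in[0,+\infty)$. Moreover, exactly one of the following two alternatives holds for the solution: (i) For every $e\in E$, $w_e(t)$ is non-decreasing in $t$ and $\lim_{t\to+\infty}w_e(t)=+\infty$; (ii) For every $e\in E$, $w_e(t)$ is non-decreasing in $t$ and converges to some positive (finite) limit $w_e^\ast>0$ as $t\to+\infty$; moreover, $\lim_{t\to+\infty}\Theta_e^\alpha(t)=0$ for all $e\in E$.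
   Context: $\mathbb{R}_+^m=\{\mathbf{a}=(a_1,\dots,a_m)\in\mathbb{R}^m: a_j>0 \text{ for all } 1\le j\le m\}$. A connected finite weighted graph $G=(V,E,\mathbf{w})$ is a finite connected simple undirected graph with vertex set $V=\{x_1,\dots,x_n\}$, edge set $E=\{e_1,\dots,e_m\}$ ($m\ge 1$), and edge weights $\mathbf{w}=(w_e)_{e\in E}$, $w_e>0$ for all $e$. Write $x\sim y$ if $x,y$ are adjacent, $xy$ for the edge joining them, and $w_{xy}=w_{yx}$ for its weight. For $x\in V$ let $\mathscr{N}_x=\{u\in V: u\sim x \text{ or } u=x\}$. Local random walks. Fix $\alpha\in(0,1)$, a weight vector $\mathbf{w}$, and an edge $e=xy$. The local random walk starting from $x$ associated with $e=xy$ is the probability measure $\mu_x^\alpha:V\to[0,1]$ defined as follows. If $\mathscr{N}_y\setminus\mathscr{N}_x\neq\emptyset$, $$\mu_x^\alpha(z)=\begin{cases}\alpha, & z=x,\\ \alpha(1-\alpha)\dfrac{w_{xz}}{\sum_{u\sim x}w_{xu}}, & z\sim x,\\ (1-\alpha)^2\dfrac{w_{yz}}{\sum_{u\in\mathscr{N}_y\setminus\mathscr{N}_x}w_{yu}}, & z\in\mathscr{N}_y\setminus\mathscr{N}_x,\\ 0, & \text{otherwise.}\end{cases}$$ If $\mathscr{N}_y\setminus\mathscr{N}_x=\emptyset$, $$\mu_x^\alpha(z)=\begin{cases}\alpha, & z=x,\\ (1-\alpha)\dfrac{w_{xz}}{\sum_{u\sim x}w_{xu}}, & z\sim x,\\ 0,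 & \text{otherwise.}\end{cases}$$ The walk $\mu_y^\alpha$ starting from $y$ associated with $e$ is defined by the same formulas with the roles of $x$ and $y$ exchanged. Both measures depend on the edge $e$ and on $\mathbf{w}$, and each is strictly positive exactly on $\mathscr{N}_x\cup\mathscr{N}_y$. Edge entropy. For $e=xy\in E$, with $\mu_x^\alpha,\mu_y^\alpha$ the two local random walks associated with $e$, $$\Theta_e^\alpha=\sum_{z\in\mathscr{N}_x\cup\mathscr{N}_y}\left(\mu_x^\alpha(z)\log\frac{\mu_x^\alpha(z)}{\mu_y^\alpha(z)}+\mu_y^\alpha(z)\log\frac{\mu_y^\alpha(z)}{\mu_x^\alpha(z)}\right).$$ A solution of the flow on $[0,+\infty)$ is a function $\mathbf{w}$ that is continuous on $[0,+\infty)$, differentiable for $t>0$, and satisfies the displayed system. *)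

(* Defs.v *)
From mathcomp Require Import all_boot all_order all_algebra.
From mathcomp Require Import all_classical all_reals all_analysis.

Set Implicit Arguments.
Unset Strict Implicit.
Unset Printing Implicit Defensive.

Import Order.TTheory GRing.Theory Num.Theory.
Import numFieldNormedType.Exports.
Local Open Scope classical_set_scope.
Local Open Scope ring_scope.

(* A graph is an adjacency relation [adj] on a finite type [V], and the edge
   joining x and y is the unordered pair [set x; y].  A weight vector is a
   function on unordered pairs; only its values on edges are ever used, so two
   weight vectors are identified when they agree on edges. *)
Definition weights (R : realType) (V : finType) : Type := {set V} -> R.

Definition edgew (R : realType) (V : finType) (w : weights R V) (x y : V) : R :=
  w [set x; y]%SET.

Definition simple_graph (V : finType) (adj : rel V) : Prop :=
  symmetric adj /\ irreflexive adj.

Definition connected_graph (V : finType) (adj : rel V) : Prop :=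
  forall x y : V, connect adj x y.

Definition positive_weights (R : realType) (V : finType) (adj : rel V)
    (w : weights R V) : Prop :=
  forall x y : V, adj x y -> 0 < edgew w x y.

(* The closed neighbourhood of x. *)
Definition nbhd (V : finType) (adj : rel V) (x : V) : {set V} :=
  [set u | adj u x || (u == x)]%SET.

(* The local random walk starting from x associated with the edge xy; the one
   starting from y is [local_walk adj alpha w y x]. *)
Definition local_walk (R : realType) (V : finType) (adj : rel V) (alpha : R)
    (w : weights R V) (x y z : V) : R :=
  let far := (nbhd adj y :\: nbhd adj x)%SET in
  if far != finset.set0 then
    if z == x then alpha
    else if adj x z then
      alpha * (1 - alpha) * (edgew w x z / \sum_(u | adj x u) edgew w x u)
    else if z \in far then
      (1 - alpha) ^+ 2 * (edgew w y z / \sum_(u in far) edgew w y u)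
    else 0
  else
    if z == x then alpha
    else if adj x z then
      (1 - alpha) * (edgew w x z / \sum_(u | adj x u) edgew w x u)
    else 0.

Definition edge_entropy (R : realType) (V : finType) (adj : rel V) (alpha : R)
    (w : weights R V) (x y : V) : R :=
  let mux := local_walk adj alpha w x y in
  let muy := local_walk adj alpha w y x in
  \sum_(z in (nbhd adj x :|: nbhd adj y)%SET)
    (mux z * ln (mux z / muy z) + muy z * ln (muy z / mux z)).

(* Quantifying over ordered adjacent pairs (x, y) amounts to quantifying over
   edges, as the edge entropy is symmetric in x and y. The values w t for t < 0
   are irrelevant. *)
Definition flow_solution (R : realType) (V : finType) (adj : rel V) (alpha : R)
    (w0 : weights R V) (w : R -> weights R V) : Prop :=
  forall x y : V, adj x y ->
    [/\ {within `[0, +oo[, continuous (fun t : R => edgew (w t) x y)},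
        (forall t : R, 0 < t ->
           is_derive t 1 (fun s : R => edgew (w s) x y)
             (edge_entropy adj alpha (w t) x y)),
        (forall t : R, 0 < t -> 0 < edgew (w t) x y)
      & edgew (w 0) x y = edgew w0 x y].

Definition nondecreasing_from0 (R : realType) (f : R -> R) : Prop :=
  forall s t : R, 0 <= s -> s <= t -> f s <= f t.

Definition flow_diverges (R : realType) (V : finType) (adj : rel V)
    (w : R -> weights R V) : Prop :=
  forall x y : V, adj x y ->
    nondecreasing_from0 (fun t : R => edgew (w t) x y) /\
    edgew (w t) x y @[t --> +oo%R] --> +oo%R.

Definition flow_converges (R : realType) (V : finType) (adj : rel V) (alpha : R)
    (w : R -> weights R V) : Prop :=
  forall x y : V, adj x y ->
    [/\ nondecreasing_from0 (fun t : R => edgew (w t) x y),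
        (exists2 l : R, 0 < l & edgew (w t) x y @[t --> +oo%R] --> l)
      & edge_entropy adj alpha (w t) x y @[t --> +oo%R] --> (0 : R)].

(* Main.v *)
Require Import Defs.
From mathcomp Require Import all_boot all_order all_algebra.
From mathcomp Require Import all_classical all_reals all_analysis.
From mathcomp Require Import ring lra.

Set Implicit Arguments.
Unset Strict Implicit.
Unset Printing Implicit Defensive.

Import Order.TTheory GRing.Theory Num.Theory.
Import numFieldNormedType.Exports.
Local Open Scope classical_set_scope.
Local Open Scope ring_scope.

(** Every summand of the edge entropy has the form (p - q) (ln p - ln q) with
    p, q > 0, so the entropy is nonnegative and weights can only grow.  Along
    the flow all edge weights therefore stay above a fixed constant c > 0, away
    from the only singularities of the vector field (vanishing denominators and
    logarithms of 0).

    Existence and uniqueness.  On the region where all weights lie in [c, M]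
    the vector field is bounded by C M, because the walks are probabilities and
    the logarithm grows at most linearly, and its Lipschitz constant is at most
    C M^2 ([entropy_field_tame]).  These two rates are obtained compositionally:
    [tame c p q f] says that f is bounded by O(M^p) and is O(M^q)-Lipschitz
    there, and is stable under sums, products, and inverses and logarithms of
    functions bounded away from 0.  Linear
    growth keeps a solution below M(t) = A exp (C t).  So one clamps the
    weights to [c, M(t)], solves the resulting equation, which is
    Lipschitz with a continuous time-dependent constant, by Picard iteration
    on the whole half-line ([picard]), and notes that the clamping was never
    active ([tame_field_global_solution]).  Both the convergence of the
    iterates and uniqueness ([tame_field_unique]) come from the mean value
    comparison [evolves_dist_le]: if |f'| <= g' then |f - f(0)| <= g - g(0).

    Dichotomy.  Each weight is monotone, hence bounded or divergent.  Suppose xy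
    and xz are edges at x, with xy bounded and xz unbounded.  Then the walk from
    x along xy reaches y with probability tending to 0, while the walk from y
    gives y the mass alpha; so the entropy of xy stays above a positive constant
    ([edge_entropy_lower_bound]) and the weight of xy is unbounded after all.
    Hence boundedness passes to adjacent edges ([bounded_weight_adjacent]) and,
    by connectedness, from one edge to all of them.  When all weights converge,
    the entropies converge to their values at the limit; a positive limit would
    again force a weight to infinity ([bounded_flow_converges]). *)

(** * Comparison and antiderivatives on the half-line *)

(** That f is continuous on [0, +oo) is expressed by continuity of
    t |-> f (max t 0) on the whole line, which composes without subspace
    topologies. *)
Definition evolves (R : realType) (f df : R -> R) : Prop :=
  continuous (fun t : R => f (Num.max t 0)) /\
  forall t : R, 0 < t -> is_derive t 1 f (df t).

Lemma continuous_max0 (R : realType) : continuous (fun t : R => Num.max t 0).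
Proof. by move=> t; apply: continuous_max; [exact: cvg_id|exact: cvg_cst]. Qed.

Lemma evolves_within_continuous (R : realType) (f df : R -> R) :
  evolves f df -> {within `[0, +oo[, continuous f}.
Proof.
move=> [cf _]; have := continuous_subspaceT (A := `[0 : R, +oo[%classic) cf.
apply: subspace_eq_continuous => t.
rewrite inE/= in_itv/= andbT /from_subspace => t0.
by move: t0 => /max_idPl ->.
Qed.

Lemma within_continuous_max0 (R : realType) (f : R -> R) :
  {within `[0, +oo[, continuous f} -> continuous (fun t : R => f (Num.max t 0)).
Proof.
move=> cf t.
have t0 : `[0, +oo[%classic (Num.max t 0) by rewrite /= in_itv/= andbT le_max lexx orbT.
move=> P /(cf _); rewrite /nbhs/= -nbhs_subspace_in// => nP.
rewrite nbhs_simpl/=; have := continuous_max0 nP; rewrite !nbhs_simpl/=.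
by apply: filterS => s; apply; rewrite /= in_itv/= andbT le_max lexx orbT.
Qed.

Lemma evolves_derivable (R : realType) (f df : R -> R) :
  (forall t : R, -1 < t -> is_derive t 1 f (df t)) -> evolves f df.
Proof.
move=> fdf; split; last by move=> t t0; apply: fdf; lra.
move=> t; apply: (@continuous_comp _ _ _ (fun s : R => Num.max s 0) f).
  exact: continuous_max0.
apply: differentiable_continuous; apply/derivable1_diffP.
have /fdf : -1 < Num.max t 0 by rewrite lt_max; apply/orP; right; lra.
by case.
Qed.

Lemma evolves_cst (R : realType) (k : R) : evolves (fun=> k) (fun=> 0).
Proof. by split=> [? |? _]; [exact: cvg_cst|exact: is_derive_cst]. Qed.

Lemma evolves_scale (R : realType) (f df : R -> R) (k : R) :
  evolves f df -> evolves (fun t => k * f t) (fun t => k * df t).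
Proof.
case=> cf fdf; split.
  by move=> t; apply: cvgM; [exact: cvg_cst|exact: cf].
by move=> t /fdf ft; apply: is_deriveZ.
Qed.

Lemma evolves_sub (R : realType) (f df g dg : R -> R) :
  evolves f df -> evolves g dg ->
  evolves (fun t => f t - g t) (fun t => df t - dg t).
Proof.
case=> cf fdf [cg gdg]; split.
  by move=> t; apply: cvgB; [exact: cf|exact: cg].
by move=> t t0; have := fdf _ t0; have := gdg _ t0 => ? ?; apply: is_deriveB.
Qed.

Lemma evolves_le (R : realType) (f df g dg : R -> R) (s T : R) :
  evolves f df -> evolves g dg -> 0 <= s -> s <= T ->
  (forall t, s < t < T -> df t <= dg t) ->
  f T - f s <= g T - g s.
Proof.
move=> Hf Hg s0; rewrite le_eqVlt => /predU1P[<- _|sT fg]; first by rewrite !subrr.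
have Hgf := evolves_sub Hg Hf.
have dgf t : t \in `]s, T[%R -> is_derive t 1 (fun s => g s - f s) (dg t - df t).
  by rewrite in_itv/= => /andP[st _]; apply Hgf; exact: le_lt_trans st.
have cgf := evolves_within_continuous Hgf.
have sT0 : `[s, T] `<=` `[0 : R, +oo[.
  by apply: subset_itv; rewrite bnd_simp.
have [c c0 /= E] := MVT sT dgf (continuous_subspaceW sT0 cgf).
suff : 0 <= (dg c - df c) * (T - s) by lra.
by move: c0; rewrite in_itv/= => /fg c0; apply: mulr_ge0; lra.
Qed.

Lemma evolves_nondecreasing (R : realType) (f df : R -> R) :
  evolves f df -> (forall t, 0 < t -> 0 <= df t) -> nondecreasing_from0 f.
Proof.
move=> Hf df0 s t s0 st.
have := evolves_le (evolves_cst (0 : R)) Hf s0 st _.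
rewrite subrr subr_ge0; apply=> r /andP[sr _]; apply: df0; exact: le_lt_trans sr.
Qed.

(** All estimates of the existence and uniqueness proofs go through this
    comparison, which replaces integral inequalities. *)
Lemma evolves_dist_le (R : realType) (f df g dg : R -> R) (T : R) :
  evolves f df -> evolves g dg -> 0 <= T ->
  (forall t, 0 < t < T -> `|df t| <= dg t) ->
  `|f T - f 0| <= g T - g 0.
Proof.
move=> Hf Hg T0 fg; rewrite ler_norml; apply/andP; split; last first.
  by apply: (evolves_le Hf Hg (lexx 0) T0) => t /fg; exact: le_trans (ler_norm _).
rewrite lerNl -mulN1r mulrBr.
apply: (evolves_le (evolves_scale (-1) Hf) Hg (lexx 0) T0) => t /fg.
by rewrite mulN1r; apply: le_trans; rewrite -normrN ler_norm.
Qed.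

Lemma continuous_antiderivative (R : realType) (g : R -> R) (a : R) :
  continuous (fun t : R => g (Num.max t 0)) ->
  exists f, f 0 = a /\ evolves f g.
Proof.
move=> cg; pose h (t : R) := g (Num.max t 0).
(* The integral starts at -1 because the fundamental theorem gives the
   derivative only to the right of the base point, and it is needed at 0. *)
pose G (x : R) : R := (\int[lebesgue_measure]_(t in `[(-1 : R), x]) h t)%R.
have dG (t : R) : -1 < t -> is_derive t 1 G (h t).
  move=> t1; have tt : t < t + 1 by rewrite ltrDl.
  have hint : lebesgue_measure.-integrable `[(-1 : R), t + 1] (EFin \o h).
    apply: continuous_compact_integrable; first exact: segment_compact.
    exact: continuous_subspaceT.
  have [dv de] := continuous_FTC1_closed tt hint t1 (cg t).
  by split => //; rewrite -derive1E.
have [cG dG'] := evolves_derivable dG.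
exists (fun t => G t - G 0 + a); split; first by rewrite subrr add0r.
split.
  move=> t; apply: cvgD; last exact: cvg_cst.
  by apply: cvgB; [exact: cG|exact: cvg_cst].
move=> t t0; have Ht := dG' t t0.
have -> : g t = h t + 0 by rewrite addr0 /h (max_idPl (ltW t0)).
apply: (@is_deriveD _ _ _ (fun t => G t - G 0)).
rewrite -[h t]subr0.
exact: is_deriveB.
Qed.

(** * Picard iteration *)

Lemma half_expr_small (R : realType) (e eps : R) : 0 < eps ->
  exists k, 2^-1 ^+ k * e <= eps.
Proof.
move=> eps0; have [k ek] : exists k : nat, `|e| / eps < k%:R.
  by exists (Num.bound (`|e| / eps)); apply: archi_boundP; rewrite divr_ge0// ltW.
exists k; apply: (@le_trans _ _ (2^-1 ^+ k * `|e|)).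
  by rewrite ler_wpM2l ?exprn_ge0 ?ler_norm.
have k2 : k%:R <= 2 ^+ k :> R by rewrite -natrX ler_nat ltnW // ltn_expl.
rewrite exprVn mulrC ler_pdivrMr ?exprn_gt0//.
move: ek; rewrite ltr_pdivrMr// => /ltW/le_trans; apply.
by rewrite mulrC ler_pM2l.
Qed.

Lemma half_expr_le0 (R : realType) (x e : R) :
  (forall k, x <= 2^-1 ^+ k * e) -> x <= 0.
Proof.
move=> xe; rewrite leNgt; apply/negP => x0.
have [k] := half_expr_small e (divr_gt0 x0 (ltr0Sn _ 1)).
by move: (xe k) => /le_trans /[apply]; lra.
Qed.

(** The sequences a_k - r_k and a_k + r_k, with r_k = 2 (e / 2^k), are
    respectively nondecreasing and nonincreasing, so the supremum of the first
    one is squeezed between them. *)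
Lemma geometric_limit (R : realType) (a : nat -> R) (e : R) :
  (forall k, `|a k.+1 - a k| <= 2^-1 ^+ k * e) ->
  exists l, forall k, `|a k - l| <= 2 * (2^-1 ^+ k * e).
Proof.
move=> ae; pose r k := 2 * (2^-1 ^+ k * e).
have rS k : r k.+1 = r k - 2^-1 ^+ k * e by rewrite /r exprS; field.
have lo : {homo (fun k => a k - r k) : i j / (i <= j)%N >-> i <= j}.
  apply: homo_leq => [//|//|k]; first exact: le_trans.
  by rewrite rS; move: (ae k); rewrite ler_norml; lra.
have up : {homo (fun k => a k + r k) : i j / (i <= j)%N >-> j <= i}.
  apply: (@homo_leq _ _ (fun x y => y <= x)) => [//|x y z xy yz|k].
    exact: le_trans yz xy.
  by rewrite rS; move: (ae k); rewrite ler_norml; lra.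
have r0 k : 0 <= r k.
  by rewrite /r mulr_ge0//; apply: le_trans (ae k); exact: normr_ge0.
have lu i j : a i - r i <= a j + r j.
  have := lo _ _ (leq_maxl i j); have := up _ _ (leq_maxr i j).
  by have := r0 (maxn i j); lra.
exists (sup (range (fun k => a k - r k))) => k.
have ne : range (fun k => a k - r k) !=set0 by exists (a 0 - r 0)%R; exists 0%N.
have ub : has_ubound (range (fun k => a k - r k)).
  by exists (a 0 + r 0)%R => _ [i _ <-]; exact: lu.
have l1 : a k - r k <= sup (range (fun k => a k - r k)).
  by apply: ub_le_sup => //; exists k.
have l2 : sup (range (fun k => a k - r k)) <= a k + r k.
  by apply: ge_sup => // _ [i _ <-]; exact: lu.
by rewrite ler_norml -/(r k); lra.
Qed.

(** The majorant E plays the role of the exponential weight in the usual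
    contraction argument: the inequality 2 L E <= E' makes each iteration halve
    the distance measured in units of E, on the whole half-line at once and
    with a Lipschitz constant L that may depend on time. *)
Lemma picard (R : realType) (I : Type) (H : R -> (I -> R) -> I -> R)
    (E dE L : R -> R) (u0 : I -> R) :
  evolves E dE -> 0 <= E 0 ->
  (forall t, 0 <= t -> 2 * (L t * E t) <= dE t) ->
  (forall t i, 0 <= t -> `|H t u0 i| <= dE t) ->
  (forall t u v d, 0 <= t -> (forall i, `|u i - v i| <= d) ->
     forall i, `|H t u i - H t v i| <= L t * d) ->
  (forall u : I -> R -> R, (forall i, continuous (fun t : R => u i (Num.max t 0))) ->
     forall i, continuous (fun t : R =>
       H (Num.max t 0) (fun j => u j (Num.max t 0)) i)) ->
  exists u : I -> R -> R, forall i,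
    u i 0 = u0 i /\ evolves (u i) (fun t => H t (fun j => u j t) i).
Proof.
move=> HE E0 HEL Hu0 HL Hc.
pose cont (u : I -> R -> R) := forall i, continuous (fun t : R => u i (Num.max t 0)).
(* S u integrates the field along u; it is meaningful for continuous u only. *)
have [S SP] : exists S : (I -> R -> R) -> I -> R -> R, forall u, cont u ->
    forall i, S u i 0 = u0 i /\ evolves (S u i) (fun t => H t (fun j => u j t) i).
  have : forall u, exists v : I -> R -> R, cont u -> forall i,
      v i 0 = u0 i /\ evolves (v i) (fun t => H t (fun j => u j t) i).
    move=> u; have [cu|ncu] := pselect (cont u); last by exists u.
    have /choice[v vP] : forall i, exists f,
        f 0 = u0 i /\ evolves f (fun t => H t (fun j => u j t) i).
      by move=> i; apply: continuous_antiderivative; exact: Hc.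
    by exists v.
  by move=> /choice[S SP]; exists S.
pose U k := iter k S (fun i _ => u0 i).
have cU k : cont (U k).
  elim: k => [|k ih] i; first by move=> t; exact: cvg_cst.
  by have [_ []] := SP _ ih i.
have UP k i : U k.+1 i 0 = u0 i /\
    evolves (U k.+1 i) (fun t => H t (fun j => U k j t) i) := SP _ (cU k) i.
have U0 k i : U k i 0 = u0 i by case: k => [//|k]; have [] := UP k i.
have HU k t i : 0 <= t -> `|U k.+1 i t - U k i t| <= 2^-1 ^+ k * E t.
  elim: k t i => [|k ih] t i t0.
    have [_ H1] := UP 0%N i.
    have := evolves_dist_le H1 HE t0; rewrite U0 expr0 mul1r => H2.
    apply: (le_trans (H2 _)); last by rewrite gerBl.
    by move=> s /andP[s0 _]; apply: Hu0; exact: ltW.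
  have [_ H1] := UP k i; have [_ H2] := UP k.+1 i.
  have := evolves_dist_le (evolves_sub H2 H1) (evolves_scale (2^-1 ^+ k.+1) HE) t0.
  rewrite !U0 subrr subr0 => H3; apply: (le_trans (H3 _)); last first.
    by rewrite gerBl mulr_ge0// exprn_ge0.
  move=> s /andP[/ltW s0 _].
  apply: (le_trans (HL _ _ _ _ s0 (fun j => ih s j s0) i)).
  have := HEL _ s0; have : 0 <= 2^-1 ^+ k :> R by exact: exprn_ge0.
  by rewrite exprS; set x := 2^-1 ^+ k; nra.
have /choice[u uP] : forall i, exists f : R -> R, forall t, 0 <= t ->
    forall k, `|U k i t - f t| <= 2 * (2^-1 ^+ k * E t).
  move=> i; suff /choice[f fP] : forall t, exists l : R, 0 <= t ->
      forall k, `|U k i t - l| <= 2 * (2^-1 ^+ k * E t) by exists f.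
  move=> t; have [t0|_] := boolP (0 <= t); last by exists 0.
  have [l lP] := geometric_limit (fun k => HU k t i t0).
  by exists l.
have max0 (t : R) : 0 <= Num.max t 0 by rewrite le_max lexx orbT.
have cu : cont u.
  move=> i t; apply/cvgrPdist_le => eps eps0.
  have e3 : 0 < eps / 3 by lra.
  have [k kP] := half_expr_small (2 * (E (Num.max t 0) + 1)) e3.
  have cE := HE.1 t; have cUk := cU k i t.
  move/cvgrPdist_le : cE => /(_ 1 ltr01) nE.
  move/cvgrPdist_le : cUk => /(_ _ e3) nU.
  near=> s.
  have h1 := uP i _ (max0 t) k; have h2 := uP i _ (max0 s) k.
  have h3 : `|E (Num.max t 0) - E (Num.max s 0)| <= 1 by near: s.
  have h4 : `|U k i (Num.max t 0) - U k i (Num.max s 0)| <= eps / 3 by near: s.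
  have : 0 <= 2^-1 ^+ k :> R by exact: exprn_ge0.
  move: h1 h2 h3 h4 kP; rewrite !ler_norml.
  by set x := 2^-1 ^+ k; move=> /= ? ? ? ? ? ?; apply/andP; split; nra.
(* The limit u and S u are both within O(2^-k) E of the iterate k + 1. *)
have uSu i t : 0 <= t -> S u i t = u i t.
  move=> t0; apply/eqP; rewrite -subr_eq0 -normr_le0.
  apply: (@half_expr_le0 _ _ (2 * E t)) => k.
  have [Sui0 H1] := SP _ cu i; have [Uk0 H2] := UP k i.
  have H3 := uP i t t0 k.+1.
  have := evolves_dist_le (evolves_sub H1 H2) (evolves_scale (2^-1 ^+ k) HE) t0.
  rewrite Sui0 Uk0 subrr subr0 => H4.
  have {}H4 : `|S u i t - U k.+1 i t| <= 2^-1 ^+ k * E t.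
    apply: (le_trans (H4 _)); last by rewrite gerBl mulr_ge0// exprn_ge0.
    move=> s /andP[/ltW s0 _].
    have uU j : `|u j s - U k j s| <= 2 * (2^-1 ^+ k * E s).
      by rewrite distrC; exact: uP.
    apply: (le_trans (HL _ _ _ _ s0 uU i)).
    have := HEL _ s0; have : 0 <= 2^-1 ^+ k :> R by exact: exprn_ge0.
    by set x := 2^-1 ^+ k; nra.
  rewrite -(subrK (U k.+1 i t) (S u i t)) -addrA.
  apply: (le_trans (ler_normD _ _)); apply: (le_trans (lerD H4 H3)).
  by rewrite exprS; lra.
exists (S u) => i; have [Sui0 [c d]] := SP _ cu i; split=> //; split=> // t t0.
have -> : (fun j => S u j t) = (fun j => u j t).
  by apply/funext => j; apply: uSu; exact: ltW.
exact: d.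
Unshelve. all: by end_near.
Qed.

(** * Vector fields of linear growth *)

Lemma one_le_expR (R : realType) (x : R) : 0 <= x -> 1 <= expR x.
Proof. by move=> x0; apply: le_trans (expR_ge1Dx x); lra. Qed.

Lemma is_derive_exp (R : realType) (A k t : R) :
  is_derive t 1 (fun t => A * expR (k * t)) (k * (A * expR (k * t))).
Proof.
have d1 := is_deriveZ k (is_derive_id t (1 : R)).
have d2 := is_derive1_comp (is_derive_expR (k * t)) d1.
apply: is_derive_eq (is_deriveZ A d2) _.
by rewrite /GRing.scale/=; ring.
Qed.

Lemma evolves_exp (R : realType) (A k : R) :
  evolves (fun t => A * expR (k * t)) (fun t => k * (A * expR (k * t))).
Proof. by apply: evolves_derivable => t _; exact: is_derive_exp. Qed.

Definition box (R : realType) (I : Type) (c M : R) (w : I -> R) : Prop :=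
  forall i, c <= w i <= M.

(** Nonnegativity and linear growth give global solutions; the Lipschitz rate
    M^2 is the one met by the entropy. *)
Definition tame_field (R : realType) (I : Type) (c C : R)
    (F : (I -> R) -> I -> R) : Prop :=
  forall M w i, 1 <= M -> box c M w ->
    0 <= F w i <= C * M /\
    forall w' d, box c M w' -> (forall j, `|w j - w' j| <= d) ->
      `|F w i - F w' i| <= C * M ^+ 2 * d.

Lemma tame_field_cvg (R : realType) (I : finType) (c C M : R)
    (F : (I -> R) -> I -> R) (X : Type) (G : set_system X) (FG : Filter G)
    (u : X -> I -> R) (l : I -> R) (i : I) :
  tame_field c C F -> 1 <= M -> box c M l -> (\forall t \near G, box c M (u t)) ->
  (forall j, u t j @[t --> G] --> l j) ->
  F (u t) i @[t --> G] --> F l i.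
Proof.
move=> tF M1 lb ub ul; apply/cvgrPdist_le => eps eps0.
have C0 : 0 <= C.
  have [/andP[h1 h2] _] := tF _ _ i M1 lb; nra.
pose K := C * M ^+ 2 + 1.
have K0 : 0 < K by rewrite /K; nra.
have : \forall t \near G, forall j, `|l j - u t j| <= eps / K.
  apply: filter_forall => j.
  by move/cvgrPdist_le : (ul j); apply; rewrite divr_gt0.
apply: filterS2 ub => t tb /(proj2 (tF _ _ i M1 lb) _ _ tb)/le_trans; apply.
by rewrite mulrA ler_pdivrMr// mulrC ler_wpM2l ?ltW// /K; lra.
Qed.

Lemma finite_upper_bound (R : realType) (I : finType) (f : I -> R) :
  exists M, 1 <= M /\ forall i, f i <= M.
Proof.
exists (1 + \sum_i `|f i|); split; first by rewrite lerDl sumr_ge0.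
move=> i; rewrite (bigD1 i)//=; apply: (le_trans (ler_norm _)).
by rewrite addrCA lerDl addr_ge0// sumr_ge0.
Qed.

Definition clamp (R : realType) (c M x : R) := Num.min (Num.max x c) M.

Lemma clamp_bounds (R : realType) (c M x : R) : c <= M -> c <= clamp c M x <= M.
Proof.
by move=> cM; rewrite /clamp le_min ge_min le_max !lexx cM !orbT.
Qed.

Lemma clamp_id (R : realType) (c M x : R) : c <= x <= M -> clamp c M x = x.
Proof. by case/andP=> cx xM; rewrite /clamp (max_idPl cx) (min_idPl xM). Qed.

Lemma clamp_dist (R : realType) (c M x y : R) :
  `|clamp c M x - clamp c M y| <= `|x - y|.
Proof.
rewrite /clamp; apply: (@le_trans _ _ `|Num.max x c - Num.max y c|).
  move: (Num.max x c) (Num.max y c) => {}x {}y; rewrite ler_norml.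
  have := ler_norm (x - y); have := ler_norm (y - x); rewrite distrC.
  by case: (leP x M) => ?; case: (leP y M) => ?; lra.
have := ler_norm (x - y); have := ler_norm (y - x); rewrite distrC ler_norml.
by case: (leP x c) => ?; case: (leP y c) => ?; lra.
Qed.

(** A solution grows at most at the rate C M when its coordinates are below M,
    so it never crosses M(t) = A exp (C t).  The field is therefore modified by
    clamping its argument to [c, M(t)], which makes [picard] applicable without
    changing the solution. *)
Lemma tame_field_global_solution (R : realType) (I : finType) (c C : R)
    (F : (I -> R) -> I -> R) (v0 : I -> R) :
  0 < c -> 0 < C -> tame_field c C F -> (forall i, c <= v0 i) ->
  exists u : I -> R -> R, forall i,
    [/\ u i 0 = v0 i, evolves (u i) (fun t => F (fun j => u j t) i)
      & forall t, 0 <= t -> c <= u i t].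
Proof.
move=> c0 C0 tF cv0.
have [A' [A'1 v0A]] := finite_upper_bound v0.
pose A := A' + c; pose M (t : R) := A * expR (C * t).
have A1 : 1 <= A by rewrite /A; lra.
have HM : evolves M (fun t => C * M t) := evolves_exp A C.
have M0 : M 0 = A by rewrite /M mulr0 expR0 mulr1.
have AM t : 0 <= t -> A <= M t.
  by move=> t0; rewrite /M ler_peMr ?one_le_expR ?mulr_ge0//; lra.
have M1 t : 0 <= t -> 1 <= M t by move=> /AM; exact: le_trans.
have cM t : 0 <= t -> c <= M t by move=> /AM; rewrite /A; lra.
pose H t (u : I -> R) i := F (fun j => clamp c (M t) (u j)) i.
have bH t u : 0 <= t -> box c (M t) (fun j : I => clamp c (M t) (u j)).
  by move=> t0 j; apply: clamp_bounds; exact: cM.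
have Hge t u i : 0 <= t -> 0 <= H t u i <= C * M t.
  by move=> t0; case: (tF _ _ i (M1 _ t0) (bH t u t0)).
(* The derivative of exp (M^2) is 2 M M' exp (M^2) = 2 (C M^2) exp (M^2), as
   required for the Lipschitz constant C M^2. *)
pose E (t : R) := expR (M t * M t).
have HE : evolves E (fun t => E t * (2 * (C * M t ^+ 2))).
  apply: evolves_derivable => t _.
  have dM : is_derive t 1 M (C * M t) := is_derive_exp A C t.
  have d1 := is_deriveM dM dM.
  have d2 := @is_derive1_comp R expR (M * M) t _ _ (is_derive_expR (M t * M t)) d1.
  apply: is_derive_eq d2 _.
  by rewrite /GRing.scale/= -/(E t); ring.
have E1 t : 1 <= E t by apply: one_le_expR; rewrite -expr2 sqr_ge0.
have := @picard R I H E _ (fun t => C * M t ^+ 2) v0 HE.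
case.
- exact: expR_ge0.
- by move=> t _; rewrite le_eqVlt; apply/orP; left; apply/eqP; ring.
- move=> t i t0; have /andP[h1 h2] := Hge t v0 i t0; rewrite ger0_norm//.
  apply: (le_trans h2); have := M1 _ t0; have := E1 t.
  set m := M t; set e := E t => e1 m1.
  have : C * m <= C * m ^+ 2.
    by rewrite expr2 ler_pM2l// ler_peMr//; exact: le_trans m1.
  have : 0 <= C * m ^+ 2 by rewrite mulr_ge0 ?sqr_ge0// ltW.
  by set y := C * m ^+ 2; nra.
- move=> t u v d t0 uv i.
  apply: (proj2 (tF _ _ i (M1 _ t0) (bH t u t0))); first exact: bH.
  by move=> j; apply: le_trans (uv j); exact: clamp_dist.
- move=> u cu i t; have mt : 0 <= Num.max t 0 by rewrite le_max lexx orbT.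
  pose N := M (Num.max t 0) + 1.
  have MN : \forall s \near t, M (Num.max s 0) <= N.
    have /cvgrPdist_le/(_ 1 ltr01) := HM.1 t.
    by apply: filterS => s /=; rewrite ler_norml /N; lra.
  apply: (tame_field_cvg (M := N)) tF _ _ _ _.
  + by rewrite /N; have := M1 _ mt; lra.
  + by move=> j; have := bH _ (fun j => u j (Num.max t 0)) mt j; rewrite /N; lra.
  + apply: filterS MN => s sN j.
    have ms : 0 <= Num.max s 0 by rewrite le_max lexx orbT.
    by have := bH _ (fun j => u j (Num.max s 0)) ms j; lra.
  + move=> j.
    pose g (s : R) := u j (Num.max s 0).
    apply: (@continuous_min _ _ (fun s => Num.max (g s) c) (fun s => M (Num.max s 0)));
      last exact: HM.1.
    by apply: (@continuous_max _ _ g (cst c)); [exact: cu|exact: cvg_cst].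
move=> u uP; exists u => i.
(* The solution stays in the box, where clamping is the identity. *)
have cu j t : 0 <= t -> c <= u j t.
  move=> t0; have [u0 Hu] := uP j; apply: (le_trans (cv0 j)); rewrite -u0.
  by apply: (evolves_nondecreasing Hu) => // s /ltW s0; case/andP: (Hge s (u^~ s) j s0).
have uM j t : 0 <= t -> u j t <= M t.
  move=> t0; have [u0 Hu] := uP j.
  have : u j t - u j 0 <= M t - M 0.
    by apply: (evolves_le Hu HM) => // s /andP[/ltW s0 _]; case/andP: (Hge s (u^~ s) j s0).
  by rewrite u0 M0 /A; have := v0A j; lra.
have [u0 [Cu Du]] := uP i; split=> //; last by move=> t; exact: cu.
split=> // t t0; have := Du t t0; congr is_derive.
congr F; apply/funext => j; apply: clamp_id; rewrite cu ?uM//; exact: ltW.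
Qed.

(** Both solutions are nondecreasing, so on [0, T] they stay in one box, with
    Lipschitz constant L.  There their distance is at most 2^-k M exp (2 L t)
    for every k, by the same halving as in [picard]. *)
Lemma tame_field_unique (R : realType) (I : finType) (c C : R)
    (F : (I -> R) -> I -> R) (u v : I -> R -> R) :
  0 < c -> tame_field c C F ->
  (forall i, evolves (u i) (fun t => F (fun j => u j t) i)) ->
  (forall i, evolves (v i) (fun t => F (fun j => v j t) i)) ->
  (forall i t, 0 <= t -> c <= u i t) -> (forall i t, 0 <= t -> c <= v i t) ->
  (forall i, u i 0 = v i 0) ->
  forall i T, 0 <= T -> u i T = v i T.
Proof.
move=> c0 tF Hu Hv cu cv uv0 i T T0.
have [A [A1 uA]] := finite_upper_bound (fun i => u i T).
have [B [B1 vB]] := finite_upper_bound (fun i => v i T).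
pose M := A + B; have M1 : 1 <= M by rewrite /M; lra.
have upper (w : I -> R -> R) : (forall j, evolves (w j) (fun t => F (w^~ t) j)) ->
    (forall j t, 0 <= t -> c <= w j t) -> (forall j, w j T <= M) ->
    forall t, 0 <= t <= T -> box c M (w^~ t).
  move=> Hw cw wM t /andP[t0 tT] j; rewrite cw//=; apply: le_trans (wM j).
  apply: (evolves_nondecreasing (Hw j)) => // s /ltW s0.
  have [N [N1 wN]] := finite_upper_bound (w^~ s).
  have bs : box c N (w^~ s) by move=> k; rewrite cw//= wN.
  by case: (tF _ _ j N1 bs) => /andP[].
have bu := upper u Hu cu (fun j => le_trans (uA j) _).
have {}bu t : 0 <= t <= T -> box c M (u^~ t) by apply: bu; rewrite /M; lra.
have bv := upper v Hv cv (fun j => le_trans (vB j) _).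
have {}bv t : 0 <= t <= T -> box c M (v^~ t) by apply: bv; rewrite /M; lra.
pose L := C * M ^+ 2; pose E (t : R) := M * expR (2 * L * t).
have HE : evolves E (fun t => 2 * L * E t) := evolves_exp M (2 * L).
have uv k : forall t j, 0 <= t <= T -> `|u j t - v j t| <= 2^-1 ^+ k * E t.
  elim: k => [|k ih] t j /[dup] tT /andP[t0 tleT].
    have L0 : 0 <= L.
      have [/andP[h1 h2] _] := tF _ _ i M1 (bu _ tT); rewrite /L; nra.
    have := bu _ tT j; have := bv _ tT j; rewrite /= expr0 mul1r => h1 h2.
    apply: (@le_trans _ _ M); first by rewrite ler_norml; lra.
    have M0 : 0 <= M by apply: le_trans M1.
    by rewrite /E ler_peMr// one_le_expR// mulr_ge0// mulr_ge0.
  have := evolves_dist_le (evolves_sub (Hu j) (Hv j))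
    (evolves_scale (2^-1 ^+ k.+1) HE) t0.
  rewrite uv0 subrr subr0 => H; apply: (le_trans (H _)); last first.
    rewrite gerBl mulr_ge0// ?exprn_ge0// /E mulr_ge0 ?expR_ge0//; lra.
  move=> s /andP[s0 st]; have sT : 0 <= s <= T by lra.
  apply: (le_trans (proj2 (tF _ _ j M1 (bu _ sT)) _ _ (bv _ sT) (fun j => ih s j sT))).
  by rewrite -/L exprS; rewrite le_eqVlt; apply/orP; left; apply/eqP; field.
apply/eqP; rewrite -subr_eq0 -normr_le0.
by apply: (@half_expr_le0 _ _ (E T)) => k; apply: uv; rewrite T0 lexx.
Qed.

(** * Polynomial bounds on boxes *)

(** Functions of weights bounded by O(M^p) and Lipschitz with constant O(M^q)
    on the boxes [c, M]; the exponents are tracked so that the field is seen to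
    grow linearly. *)
Definition tame (R : realType) (I : Type) (c : R) (p q : nat)
    (f : (I -> R) -> R) : Prop :=
  exists C, 0 <= C /\ forall M w, 1 <= M -> box c M w ->
    `|f w| <= C * M ^+ p /\
    forall w' d, box c M w' -> 0 <= d -> (forall j, `|w j - w' j| <= d) ->
      `|f w - f w'| <= C * M ^+ q * d.

Lemma tame_le (R : realType) (I : Type) (c : R) (p q p' q' : nat)
    (f : (I -> R) -> R) :
  (p <= p')%N -> (q <= q')%N -> tame c p q f -> tame c p' q' f.
Proof.
move=> pp' qq' [C [C0 fC]]; exists C; split=> // M w M1 wb.
have [f1 f2] := fC _ _ M1 wb; split.
  by apply: (le_trans f1); rewrite ler_wpM2l// ler_weXn2l.
move=> w' d w'b d0 ww'; apply: (le_trans (f2 _ _ w'b d0 ww')).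
by rewrite ler_wpM2r// ler_wpM2l// ler_weXn2l.
Qed.

Lemma tame_ext (R : realType) (I : Type) (c : R) (p q : nat)
    (f g : (I -> R) -> R) :
  (forall w, (forall i, c <= w i) -> f w = g w) -> tame c p q f -> tame c p q g.
Proof.
move=> fg [C [C0 fC]]; exists C; split=> // M w M1 wb.
have ge v : box c M v -> f v = g v by move=> vb; apply: fg => i; case/andP: (vb i).
have [f1 f2] := fC _ _ M1 wb; rewrite -ge//; split=> // w' d w'b.
by rewrite -ge//; exact: f2.
Qed.

Lemma tame_cst (R : realType) (I : Type) (c k : R) :
  tame c 0 0 (fun _ : I -> R => k).
Proof.
exists `|k|; split=> // M w M1 _; split; first by rewrite expr0 mulr1.
by move=> w' d _ d0 _; rewrite subrr normr0 !mulr_ge0.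
Qed.

Lemma tame_coord (R : realType) (I : Type) (c : R) (i : I) :
  0 < c -> tame c 1 0 (fun w => w i).
Proof.
move=> c0; exists 1; split=> // M w M1 wb; split.
  by rewrite mul1r expr1; have := wb i; rewrite ler_norml; lra.
by move=> w' d _ _ /(_ i); rewrite expr0 !mul1r.
Qed.

Lemma tameD (R : realType) (I : Type) (c : R) (p q : nat) (f g : (I -> R) -> R) :
  tame c p q f -> tame c p q g -> tame c p q (fun w => f w + g w).
Proof.
move=> [C [C0 fC]] [D [D0 gD]]; exists (C + D); split; first exact: addr_ge0.
move=> M w M1 wb; have [f1 f2] := fC _ _ M1 wb; have [g1 g2] := gD _ _ M1 wb.
split; first by rewrite mulrDl; exact: le_trans (ler_normD _ _) (lerD f1 g1).
move=> w' d w'b d0 ww'; rewrite !mulrDl opprD addrACA.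
exact: le_trans (ler_normD _ _) (lerD (f2 _ _ w'b d0 ww') (g2 _ _ w'b d0 ww')).
Qed.

Lemma tame_sum (R : realType) (I : Type) (c : R) (p q : nat) (J : finType)
    (P : pred J) (f : J -> (I -> R) -> R) :
  (forall j, P j -> tame c p q (f j)) -> tame c p q (fun w => \sum_(j | P j) f j w).
Proof.
move=> tf; elim: (index_enum J) => [|j s ih].
  apply: (tame_ext (f := fun=> 0)) => [w _|]; first by rewrite big_nil.
  exact: tame_le (leq0n p) (leq0n q) (tame_cst I c 0).
have [Pj|nPj] := boolP (P j).
  by apply: tame_ext (tameD (tf _ Pj) ih) => w _; rewrite big_cons Pj.
by apply: tame_ext ih => w _; rewrite big_cons (negbTE nPj).
Qed.

Lemma tameM (R : realType) (I : Type) (c : R) (p q p' q' : nat)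
    (f g : (I -> R) -> R) :
  (p <= q)%N -> (p' <= q')%N -> tame c p q f -> tame c p' q' g ->
  tame c (p + p') (q + q') (fun w => f w * g w).
Proof.
move=> pq pq' [C [C0 fC]] [D [D0 gD]]; exists (2 * (C * D)).
split; first by rewrite !mulr_ge0.
move=> M w M1 wb; have [f1 f2] := fC _ _ M1 wb; have [g1 g2] := gD _ _ M1 wb.
have Mn n : 0 <= M ^+ n by rewrite exprn_ge0//; lra.
split.
  apply: (@le_trans _ _ ((C * M ^+ p) * (D * M ^+ p'))).
    by rewrite normrM ler_pM.
  rewrite mulrACA -exprD ler_wpM2r// ler_peMl ?mulr_ge0//; lra.
move=> w' d w'b d0 ww'; have [g1' _] := gD _ _ M1 w'b.
have -> : f w * g w - f w' * g w' = f w * (g w - g w') + g w' * (f w - f w') by ring.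
apply: (le_trans (ler_normD _ _)); rewrite !normrM.
apply: (@le_trans _ _ ((C * M ^+ q) * (D * M ^+ q' * d) +
                       (D * M ^+ q') * (C * M ^+ q * d))).
  apply: lerD; apply: ler_pM => //.
  - by apply: (le_trans f1); rewrite ler_wpM2l// ler_weXn2l.
  - exact: g2.
  - by apply: (le_trans g1'); rewrite ler_wpM2l// ler_weXn2l.
  - exact: f2.
by rewrite exprD le_eqVlt; apply/orP; left; apply/eqP; ring.
Qed.

Lemma tameZ (R : realType) (I : Type) (c k : R) (p q : nat) (f : (I -> R) -> R) :
  (p <= q)%N -> tame c p q f -> tame c p q (fun w => k * f w).
Proof. by move=> pq; exact: (tameM (leqnn 0) pq (tame_cst I c k)). Qed.

Lemma tameB (R : realType) (I : Type) (c : R) (p q : nat) (f g : (I -> R) -> R) :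
  (p <= q)%N -> tame c p q f -> tame c p q g -> tame c p q (fun w => f w - g w).
Proof.
move=> pq tf tg; apply: tame_ext (tameD tf (tameZ (-1) pq tg)) => w _.
by rewrite mulN1r.
Qed.

(** The product rule overestimates the size of a quotient known to be a
    probability; this restores the right exponent. *)
Lemma tame_bounded (R : realType) (I : Type) (c K : R) (p q : nat)
    (f : (I -> R) -> R) :
  (forall w, (forall i, c <= w i) -> `|f w| <= K) ->
  tame c p q f -> tame c 0 q f.
Proof.
move=> fK [C [C0 fC]]; exists (C + `|K|); split; first exact: addr_ge0.
move=> M w M1 wb; have [_ f2] := fC _ _ M1 wb; split.
  rewrite expr0 mulr1; apply: (@le_trans _ _ K).
    by apply: fK => i; case/andP: (wb i).
  by apply: (le_trans (ler_norm K)); rewrite lerDr.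
move=> w' d w'b d0 ww'; apply: (le_trans (f2 _ _ w'b d0 ww')).
rewrite ler_wpM2r// ler_wpM2r ?lerDl// exprn_ge0//; lra.
Qed.

Lemma tame_inv (R : realType) (I : Type) (c k : R) (p q : nat)
    (f : (I -> R) -> R) :
  0 < k -> (forall w, (forall i, c <= w i) -> k <= f w) ->
  tame c p q f -> tame c 0 q (fun w => (f w)^-1).
Proof.
move=> k0 kf [C [C0 fC]].
apply: (@tame_bounded _ _ _ k^-1 0).
  move=> w /kf kfw; rewrite normfV ger0_norm ?lef_pV2 ?posrE//; lra.
exists (k^-1 + C / k ^+ 2); split.
  by rewrite addr_ge0 ?divr_ge0 ?invr_ge0 ?exprn_ge0// ltW.
move=> M w M1 wb; have kw v : box c M v -> k <= f v.
  by move=> vb; apply: kf => i; case/andP: (vb i).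
have kfw := kw _ wb; have k2 : 0 < k ^+ 2 by rewrite exprn_gt0.
have Ck : 0 <= C / k ^+ 2 by rewrite divr_ge0// ltW.
have Vk : 0 <= k^-1 by rewrite invr_ge0 ltW.
have [_ f2] := fC _ _ M1 wb; split.
  rewrite expr0 mulr1 normfV ger0_norm; last lra.
  by apply: (@le_trans _ _ k^-1); [rewrite lef_pV2 ?posrE; lra|rewrite lerDl].
move=> w' d w'b d0 ww'; have kfw' := kw _ w'b; have := f2 _ _ w'b d0 ww'.
have -> : (f w)^-1 - (f w')^-1 = (f w' - f w) / (f w * f w').
  by field; apply/andP; split; apply: lt0r_neq0; lra.
rewrite normrM normfV distrC (ger0_norm (mulr_ge0 _ _)); try lra.
move=> h; apply: (@le_trans _ _ (C * M ^+ q * d / k ^+ 2)).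
  apply: ler_pM => //; first by rewrite invr_ge0 mulr_ge0//; lra.
  rewrite lef_pV2 ?posrE ?mulr_gt0//; try lra.
  by rewrite expr2 ler_pM//; exact: ltW.
rewrite mulrAC [_ * M ^+ q / _]mulrAC -!mulrA [X in X <= _]mulrA ler_wpM2r ?lerDr//.
by rewrite mulr_ge0// exprn_ge0//; lra.
Qed.

Lemma ln_dist_le (R : realType) (k a b : R) :
  0 < k -> k <= a -> k <= b -> `|ln a - ln b| <= `|a - b| / k.
Proof.
move=> k0; wlog ba : a b / b <= a => [hw|] ka kb.
  by case/orP: (le_total b a) => h; [|rewrite distrC (distrC a)]; exact: hw.
have a0 : 0 < a by lra.
have b0 : 0 < b by lra.
rewrite ger0_norm; last by rewrite subr_ge0 ler_ln.
rewrite -ln_div ?posrE// ger0_norm; last by rewrite subr_ge0.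
have -> : a / b = 1 + (a - b) / b by field; exact: lt0r_neq0.
have ab0 : 0 <= (a - b) / b by rewrite divr_ge0; lra.
apply: (@le_trans _ _ ((a - b) / b)); first by apply: le_ln1Dx; lra.
by rewrite ler_wpM2l ?lef_pV2 ?posrE; lra.
Qed.

(** The upper bound uses only ln s <= s; since the walks enter the entropy linearly,
    this crude growth is enough. *)
Lemma tame_ln (R : realType) (I : Type) (c k : R) (f : (I -> R) -> R) :
  0 < k -> (forall w, (forall i, c <= w i) -> k <= f w) ->
  tame c 1 1 f -> tame c 1 1 (fun w => ln (f w)).
Proof.
move=> k0 kf [C [C0 fC]]; exists (`|ln k| + C + C / k).
have Ck : 0 <= C / k by rewrite divr_ge0// ltW.
split; first by rewrite !addr_ge0.
move=> M w M1 wb; have kw v : box c M v -> k <= f v.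
  by move=> vb; apply: kf => i; case/andP: (vb i).
have kfw := kw _ wb; have [+ f2] := fC _ _ M1 wb; rewrite !expr1 => f1; split.
  have h1 : ln k <= ln (f w) by rewrite ler_ln ?posrE; lra.
  have h2 : ln (f w) < f w by apply: ln_sublinear; lra.
  have h3 := ler_norm (f w); have h4 : - `|ln k| <= ln k by rewrite lerNnormlW.
  have h5 : 0 <= `|ln k| by [].
  by rewrite ler_norml; apply/andP; split; nra.
move=> w' d w'b d0 ww'; have kfw' := kw _ w'b; have := f2 _ _ w'b d0 ww'.
rewrite expr1 => h; apply: (le_trans (ln_dist_le k0 kfw kfw')).
apply: (@le_trans _ _ (C / k * M * d)).
  by rewrite ler_pdivrMr//; apply: (le_trans h); rewrite le_eqVlt; apply/orP; left;
    apply/eqP; field; exact: lt0r_neq0.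
have h6 : 0 <= M * d by rewrite mulr_ge0//; lra.
rewrite -mulrA -[X in _ <= X]mulrA ler_wpM2r// lerDr addr_ge0//.
Qed.

(** * Local random walks and edge entropy *)

Definition weight_share (R : realType) (V : finType) (a : V) (P : pred V) (b : V)
    (w : weights R V) : R :=
  edgew w a b / \sum_(u | P u) edgew w a u.

Lemma weight_le_sum (R : realType) (V : finType) (a : V) (P : pred V) (b : V)
    (w : weights R V) :
  P b -> (forall u, P u -> 0 < edgew w a u) ->
  edgew w a b <= \sum_(u | P u) edgew w a u.
Proof.
move=> Pb w0; rewrite (bigD1 b)//= lerDl; apply: sumr_ge0 => u /andP[Pu _].
exact/ltW/w0.
Qed.

Lemma weight_share_bounds (R : realType) (V : finType) (a : V) (P : pred V) (b : V)
    (w : weights R V) :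
  P b -> (forall u, P u -> 0 < edgew w a u) -> 0 < weight_share a P b w <= 1.
Proof.
move=> Pb w0; have wb := w0 _ Pb; have ws := weight_le_sum Pb w0.
have s0 := lt_le_trans wb ws.
by rewrite /weight_share divr_gt0//= ler_pdivrMr// mul1r.
Qed.

Lemma tame_weight_sum (R : realType) (V : finType) (c : R) (a : V) (P : pred V) :
  0 < c -> tame c 1 0 (fun w : weights R V => \sum_(u | P u) edgew w a u).
Proof. by move=> c0; apply: tame_sum => u _; exact: tame_coord. Qed.

Lemma tame_weight_share (R : realType) (V : finType) (c : R) (a : V) (P : pred V)
    (b : V) :
  0 < c -> P b -> tame c 0 1 (weight_share (R := R) a P b).
Proof.
move=> c0 Pb; have pos (w : weights R V) : (forall i, c <= w i) ->
    forall u, P u -> 0 < edgew w a u.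
  by move=> cw u _; apply: lt_le_trans (cw _).
apply: (@tame_bounded _ _ _ 1 1).
  move=> w /pos /(weight_share_bounds Pb)/andP[s0 s1].
  by rewrite ger0_norm// ltW.
apply: (@tameM _ _ _ 1 1 0 0) => //.
  by apply: (tame_le (p := 1) (q := 0)) => //; exact: tame_coord.
apply: (tame_inv c0) (tame_weight_sum a P c0) => w cw.
by apply: le_trans (weight_le_sum Pb (pos w cw)); exact: cw.
Qed.

Lemma tame_ln_weight_share (R : realType) (V : finType) (c k : R) (a : V)
    (P : pred V) (b : V) :
  0 < c -> 0 < k -> P b ->
  tame c 1 1 (fun w => ln (k * weight_share (R := R) a P b w)).
Proof.
move=> c0 k0 Pb.
have ab w : (forall i, c <= w i) -> c <= edgew w a b by move=> cw; exact: cw.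
have as_ w : (forall i, c <= w i) -> c <= \sum_(u | P u) edgew w a u.
  move=> cw; apply: le_trans (ab _ cw) (weight_le_sum Pb _) => u _.
  exact: lt_le_trans (cw _).
apply: (tame_ext (f := fun w =>
    ln k + (ln (edgew w a b) - ln (\sum_(u | P u) edgew w a u)))).
  move=> w cw; have h1 := ab _ cw; have h2 := as_ _ cw.
  by rewrite lnM ?ln_div// posrE ?divr_gt0//; lra.
apply: tameD; first exact: tame_le (tame_cst _ _ _).
apply: tameB => //; apply: (tame_ln c0) => //; apply: (tame_le (p := 1) (q := 0)) => //.
  exact: tame_coord.
exact: tame_weight_sum.
Qed.

(** On its support a local walk is, as a function of the weights, either
    constant or a constant multiple of the share of one edge in the total weight
    of a set of edges at one vertex.  Which case occurs depends on the graph
    alone, so positivity, [tame] estimates and dependence on edge weights only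
    all reduce to the corresponding facts about shares. *)
Lemma local_walk_shape (R : realType) (V : finType) (adj : rel V) (alpha : R)
    (x y z : V) :
  symmetric adj -> irreflexive adj -> 0 < alpha -> alpha < 1 -> adj x y ->
  z \in (nbhd adj x :|: nbhd adj y)%SET ->
  (exists2 k, 0 < k & forall w, local_walk adj alpha w x y z = k) \/
  (exists k a b (P : pred V), [/\ 0 < k, P b, (forall u, P u -> adj a u) &
     forall w, local_walk adj alpha w x y z = k * weight_share a P b w]).
Proof.
move=> sym irr a0 a1 xy zxy; rewrite /local_walk.
have a1' : 0 < 1 - alpha by rewrite subr_gt0.
rewrite !inE in zxy.
have [zx|zx] := eqVneq z x; first by left; exists alpha => // w; case: ifP.
rewrite !(negbTE zx) !orbF (sym z x) in zxy.
have [xz|xz] := boolP (adj x z).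
  right; exists (if (nbhd adj y :\: nbhd adj x)%SET != finset.set0
                 then alpha * (1 - alpha) else 1 - alpha), x, z, (adj x).
  by split=> [||//|w]; [case: ifP; rewrite ?mulr_gt0|by []|case: ifP].
rewrite (negbTE xz)/= in zxy.
have zfar : z \in (nbhd adj y :\: nbhd adj x)%SET.
  by rewrite !inE (negbTE zx) (sym z x) (negbTE xz).
have -> : (nbhd adj y :\: nbhd adj x)%SET != finset.set0.
  by apply/set0Pn; exists z.
right; exists ((1 - alpha) ^+ 2), y, z, (mem (nbhd adj y :\: nbhd adj x)%SET).
split=> //; first by rewrite exprn_gt0.
  move=> u; rewrite /= !inE negb_or => /andP[/andP[nux ux] /orP[|/eqP uy]].
    by rewrite sym.
  by move: nux; rewrite uy sym xy.
by move=> w; rewrite zfar.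
Qed.

Lemma local_walk_gt0 (R : realType) (V : finType) (adj : rel V) (alpha : R)
    (w : weights R V) (x y z : V) :
  symmetric adj -> irreflexive adj -> 0 < alpha -> alpha < 1 -> adj x y ->
  z \in (nbhd adj x :|: nbhd adj y)%SET -> positive_weights adj w ->
  0 < local_walk adj alpha w x y z.
Proof.
move=> sym irr a0 a1 xy zxy w0.
have [[k k0 ->//]|[k [a [b [P [k0 Pb Pa ->]]]]]] :=
  local_walk_shape sym irr a0 a1 xy zxy.
rewrite mulr_gt0//.
by have /andP[] := weight_share_bounds Pb (fun u Pu => w0 _ _ (Pa u Pu)).
Qed.

Lemma tame_local_walk (R : realType) (V : finType) (adj : rel V) (alpha c : R)
    (x y z : V) :
  symmetric adj -> irreflexive adj -> 0 < alpha -> alpha < 1 -> 0 < c -> adj x y ->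
  z \in (nbhd adj x :|: nbhd adj y)%SET ->
  tame c 0 1 (fun w => local_walk adj alpha w x y z) /\
  tame c 1 1 (fun w => ln (local_walk adj alpha w x y z)).
Proof.
move=> sym irr a0 a1 c0 xy zxy.
have [[k k0 kw]|[k [a [b [P [k0 Pb Pa kw]]]]]] :=
  local_walk_shape sym irr a0 a1 xy zxy.
  split; first by apply: (tame_ext (f := fun=> k)) => //; exact: tame_le (tame_cst _ _ _).
  apply: (tame_ext (f := fun=> ln k)) => [w _|]; first by rewrite kw.
  exact: tame_le (tame_cst _ _ _).
split.
  apply: (tame_ext (f := fun w => k * weight_share a P b w)) => //.
  by apply: tameZ => //; exact: tame_weight_share.
apply: (tame_ext (f := fun w => ln (k * weight_share a P b w))) => [w _|].
  by rewrite kw.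
exact: tame_ln_weight_share.
Qed.

Lemma local_walk_ext (R : realType) (V : finType) (adj : rel V) (alpha : R)
    (w w' : weights R V) (x y z : V) :
  symmetric adj -> irreflexive adj -> 0 < alpha -> alpha < 1 -> adj x y ->
  z \in (nbhd adj x :|: nbhd adj y)%SET ->
  (forall a b, adj a b -> edgew w a b = edgew w' a b) ->
  local_walk adj alpha w x y z = local_walk adj alpha w' x y z.
Proof.
move=> sym irr a0 a1 xy zxy ww'.
have [[k k0 kw]|[k [a [b [P [k0 Pb Pa kw]]]]]] :=
  local_walk_shape sym irr a0 a1 xy zxy; rewrite !kw// /weight_share ww' ?Pa//.
by under eq_bigr => u Pu do rewrite ww' ?Pa//.
Qed.

Lemma edge_entropy_sym (R : realType) (V : finType) (adj : rel V) (alpha : R)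
    (w : weights R V) (x y : V) :
  edge_entropy adj alpha w x y = edge_entropy adj alpha w y x.
Proof.
by rewrite /edge_entropy finset.setUC; apply: eq_bigr => z _; rewrite addrC.
Qed.

Lemma edge_entropy_ext (R : realType) (V : finType) (adj : rel V) (alpha : R)
    (w w' : weights R V) (x y : V) :
  symmetric adj -> irreflexive adj -> 0 < alpha -> alpha < 1 -> adj x y ->
  (forall a b, adj a b -> edgew w a b = edgew w' a b) ->
  edge_entropy adj alpha w x y = edge_entropy adj alpha w' x y.
Proof.
move=> sym irr a0 a1 xy ww'; apply: eq_bigr => z zxy.
have zyx : z \in (nbhd adj y :|: nbhd adj x)%SET by rewrite finset.setUC.
have yx : adj y x by rewrite sym.
by rewrite !(@local_walk_ext _ _ _ _ w w' x y z) ?(@local_walk_ext _ _ _ _ w w' y x z).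
Qed.

(** In this form the summands are visibly nonnegative, and only the logarithm of
    each walk, not of their quotient, has to be estimated. *)
Lemma edge_entropyE (R : realType) (V : finType) (adj : rel V) (alpha : R)
    (w : weights R V) (x y : V) :
  symmetric adj -> irreflexive adj -> 0 < alpha -> alpha < 1 -> adj x y ->
  positive_weights adj w ->
  edge_entropy adj alpha w x y =
  \sum_(z in (nbhd adj x :|: nbhd adj y)%SET)
    (local_walk adj alpha w x y z - local_walk adj alpha w y x z) *
    (ln (local_walk adj alpha w x y z) - ln (local_walk adj alpha w y x z)).
Proof.
move=> sym irr a0 a1 xy w0; apply: eq_bigr => z zxy.
have zyx : z \in (nbhd adj y :|: nbhd adj x)%SET by rewrite finset.setUC.
have yx : adj y x by rewrite sym.
have h1 := local_walk_gt0 sym irr a0 a1 xy zxy w0.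
have h2 := local_walk_gt0 sym irr a0 a1 yx zyx w0.
by rewrite !ln_div ?posrE//; ring.
Qed.

Lemma subr_ln_ge0 (R : realType) (p q : R) :
  0 < p -> 0 < q -> 0 <= (p - q) * (ln p - ln q).
Proof.
move=> p0 q0; case/orP: (le_total p q) => pq.
  by apply: mulr_le0; rewrite subr_le0// ler_ln.
by apply: mulr_ge0; rewrite subr_ge0// ler_ln.
Qed.

Lemma edge_entropy_ge_term (R : realType) (V : finType) (adj : rel V) (alpha : R)
    (w : weights R V) (x y z : V) :
  symmetric adj -> irreflexive adj -> 0 < alpha -> alpha < 1 -> adj x y ->
  positive_weights adj w -> z \in (nbhd adj x :|: nbhd adj y)%SET ->
  0 <= (local_walk adj alpha w x y z - local_walk adj alpha w y x z) *
    (ln (local_walk adj alpha w x y z) - ln (local_walk adj alpha w y x z))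
    <= edge_entropy adj alpha w x y.
Proof.
move=> sym irr a0 a1 xy w0 zxy; rewrite edge_entropyE//.
have yx : adj y x by rewrite sym.
have ge0 v : v \in (nbhd adj x :|: nbhd adj y)%SET ->
  0 <= (local_walk adj alpha w x y v - local_walk adj alpha w y x v) *
    (ln (local_walk adj alpha w x y v) - ln (local_walk adj alpha w y x v)).
  move=> vxy; apply: subr_ln_ge0; apply: local_walk_gt0 => //.
  by rewrite finset.setUC.
rewrite ge0//= (bigD1 z)//= lerDl; apply: sumr_ge0 => v /andP[vxy _].
exact: ge0.
Qed.

Lemma edge_entropy_ge0 (R : realType) (V : finType) (adj : rel V) (alpha : R)
    (w : weights R V) (x y : V) :
  symmetric adj -> irreflexive adj -> 0 < alpha -> alpha < 1 -> adj x y ->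
  positive_weights adj w -> 0 <= edge_entropy adj alpha w x y.
Proof.
move=> sym irr a0 a1 xy w0.
have xx : x \in (nbhd adj x :|: nbhd adj y)%SET by rewrite !inE eqxx orbT.
have /andP[] := edge_entropy_ge_term sym irr a0 a1 xy w0 xx.
exact: le_trans.
Qed.

Lemma tame_edge_entropy (R : realType) (V : finType) (adj : rel V) (alpha c : R)
    (x y : V) :
  symmetric adj -> irreflexive adj -> 0 < alpha -> alpha < 1 -> 0 < c -> adj x y ->
  tame c 1 2 (fun w => edge_entropy adj alpha w x y).
Proof.
move=> sym irr a0 a1 c0 xy.
have pos (w : weights R V) : (forall i, c <= w i) -> positive_weights adj w.
  by move=> cw u v _; exact: lt_le_trans (cw _).
apply: tame_ext.
  by move=> w cw; symmetry; apply: edge_entropyE => //; exact: pos.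
apply: tame_sum => z zxy.
have zyx : z \in (nbhd adj y :|: nbhd adj x)%SET by rewrite finset.setUC.
have yx : adj y x by rewrite sym.
have [t1 l1] := tame_local_walk sym irr a0 a1 c0 xy zxy.
have [t2 l2] := tame_local_walk sym irr a0 a1 c0 yx zyx.
apply: (@tameM _ _ _ 0 1 1 1) => //; exact: tameB.
Qed.

(** When the weight of xy is small compared to that of xz, the walk from x
    gives y at most the mass alpha / 2, while the walk from y gives it alpha;
    the term at y alone is then at least (alpha / 2) ln 2. *)
Lemma edge_entropy_lower_bound (R : realType) (V : finType) (adj : rel V) (alpha : R)
    (w : weights R V) (x y z : V) :
  symmetric adj -> irreflexive adj -> 0 < alpha -> alpha < 1 ->
  adj x y -> adj x z -> positive_weights adj w ->
  edgew w x y <= alpha / 2 * edgew w x z ->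
  alpha / 2 * ln 2 <= edge_entropy adj alpha w x y.
Proof.
move=> sym irr a0 a1 xy xz w0 yz.
have yin : y \in (nbhd adj x :|: nbhd adj y)%SET by rewrite !inE eqxx !orbT.
have /andP[_ /(le_trans _)->//] := edge_entropy_ge_term sym irr a0 a1 xy w0 yin.
have p0 := local_walk_gt0 sym irr a0 a1 xy yin w0.
have -> : local_walk adj alpha w y x y = alpha.
  by rewrite /local_walk eqxx; case: ifP.
have : local_walk adj alpha w x y y <= alpha / 2.
  have yx : (y == x) = false by apply/eqP => E; rewrite E irr in xy.
  have share : weight_share x (adj x) y w <= alpha / 2.
    have xz0 := w0 _ _ xz; have ws := weight_le_sum (P := adj x) xz (w0 x).
    rewrite /weight_share ler_pdivrMr; last exact: lt_le_trans ws.
    by apply: (le_trans yz); rewrite ler_wpM2l//; lra.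
  have /andP[s0 _] := weight_share_bounds (P := adj x) xy (w0 x).
  move: share s0; rewrite /local_walk yx xy -/(weight_share x (adj x) y w).
  by set s := weight_share _ _ _ _ => s1 s0; case: ifP => _; nra.
move: p0; set p := local_walk _ _ _ _ _ _ => p0 pa.
have l2 : ln 2 <= ln alpha - ln p.
  by rewrite -ln_div ?posrE// ler_ln ?posrE ?divr_gt0// ler_pdivlMr//; lra.
have l20 : 0 < ln 2 :> R by rewrite ln_gt0//; lra.
rewrite -[X in _ <= X]mulrNN !opprB; apply: ler_pM => //; lra.
Qed.

(** * The entropy flow as a differential equation *)

(** The entropy is defined on ordered pairs; by symmetry any orientation of an
    edge may be picked.  Pairs that are not edges do not move. *)
Definition entropy_field (R : realType) (V : finType) (adj : rel V) (alpha : R)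
    (w : weights R V) (e : {set V}) : R :=
  if [pick p : V * V | adj p.1 p.2 && (e == [set p.1; p.2]%SET)] is Some p
  then edge_entropy adj alpha w p.1 p.2 else 0.

Lemma set2_eqP (T : finType) (a b x y : T) :
  [set a; b]%SET = [set x; y]%SET -> (a = x /\ b = y) \/ (a = y /\ b = x).
Proof.
move=> E; have := set21 a b; have := set22 a b; rewrite E !inE.
have := set21 x y; have := set22 x y; rewrite -E !inE.
by do 4! [case/orP=> /eqP ?]; subst; by [left|right].
Qed.

Lemma entropy_field_edge (R : realType) (V : finType) (adj : rel V) (alpha : R)
    (w : weights R V) (x y : V) :
  adj x y -> entropy_field adj alpha w [set x; y]%SET = edge_entropy adj alpha w x y.
Proof.
move=> xy; rewrite /entropy_field; case: pickP => [[a b]/=|]; last first.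
  by move=> /(_ (x, y)); rewrite /= xy eqxx.
case/andP=> _ /eqP/set2_eqP[[<- <-//]|[-> ->]]; exact: edge_entropy_sym.
Qed.

Lemma entropy_field_tame (R : realType) (V : finType) (adj : rel V) (alpha c : R) :
  symmetric adj -> irreflexive adj -> 0 < alpha -> alpha < 1 -> 0 < c ->
  exists2 C, 0 < C & tame_field c C (entropy_field (R := R) adj alpha).
Proof.
move=> sym irr a0 a1 c0.
have te e : tame c 1 2 (fun w => entropy_field (R := R) adj alpha w e).
  rewrite /entropy_field; case: pickP => [[a b]/= /andP[ab _]|_].
    exact: tame_edge_entropy.
  exact: tame_le (tame_cst _ _ _).
have /choice[K KP] := te; have [C [C1 KC]] := finite_upper_bound K.
exists C; first lra.
move=> M w e M1 wb; have [K0 /(_ M w M1 wb)[f1 f2]] := KP e; split.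
  apply/andP; split.
    rewrite /entropy_field; case: pickP => [[a b]/= /andP[ab _]|//].
    apply: edge_entropy_ge0 => // u v _; apply: lt_le_trans c0 _.
    by case/andP: (wb [set u; v]%SET).
  apply: (le_trans (ler_norm _)); apply: (le_trans f1).
  by rewrite expr1 ler_wpM2r//; lra.
move=> w' d w'b ww'; have d0 : 0 <= d by apply: le_trans (ww' e).
apply: (le_trans (f2 _ _ w'b d0 ww')).
by rewrite ler_wpM2r// ler_wpM2r// exprn_ge0//; lra.
Qed.

Lemma evolves_unbounded (R : realType) (f df : R -> R) (d t0 : R) :
  evolves f df -> 0 <= t0 -> 0 < d -> (forall t, t0 < t -> d <= df t) ->
  forall B, exists2 t, 0 <= t & B < f t.
Proof.
move=> Hf t00 d0 fd B.
pose t := t0 + (`|B - f t0| + 1) / d.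
have tt0 : t0 <= t by rewrite lerDl divr_ge0 ?addr_ge0// ltW.
exists t; first exact: le_trans tt0.
have Hd : evolves (fun s => d * s) (fun=> d * 1).
  by apply: evolves_scale; apply: evolves_derivable => s _; exact: is_derive_id.
have : d * t - d * t0 <= f t - f t0.
  apply: (evolves_le Hd Hf t00 tt0) => s /andP[ts _]; rewrite mulr1; exact: fd.
have -> : d * t - d * t0 = `|B - f t0| + 1 by rewrite /t; field; exact: lt0r_neq0.
by have := ler_norm (B - f t0); lra.
Qed.

Lemma nondecreasing_unbounded_cvgy (R : realType) (f : R -> R) :
  nondecreasing_from0 f -> (forall B, exists2 t, 0 <= t & B < f t) ->
  f t @[t --> +oo%R] --> +oo%R.
Proof.
move=> fnd funb; apply/cvgryPge => A; have [s s0 As] := funb A.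
have : \forall t \near +oo%R, s <= t by exact: nbhs_pinfty_ge (num_real _).
by apply: filterS => t st; apply: (le_trans (ltW As)); exact: fnd.
Qed.

Lemma nondecreasing_bounded_cvg (R : realType) (f : R -> R) (B : R) :
  nondecreasing_from0 f -> (forall t, 0 <= t -> f t <= B) ->
  exists l, f t @[t --> +oo%R] --> l /\ forall t, 0 <= t -> f t <= l.
Proof.
move=> fnd fB; pose g (t : R) := f (Num.max t 0).
have m0 (t : R) : 0 <= Num.max t 0 by rewrite le_max lexx orbT.
have gub : has_ubound (range g) by exists B => _ [t _ <-]; exact: fB.
have gnd : {homo g : s t / s <= t}.
  move=> s t st; apply: fnd => //.
  by rewrite ge_max !le_max st lexx !orbT.
exists (sup (range g)); split; last first.
  move=> t t0; have -> : f t = g t by rewrite /g (max_idPl t0).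
  by apply: ub_le_sup => //; exists t.
have := nondecreasing_cvgr gnd gub; apply: cvg_trans; apply: near_eq_cvg.
have : \forall t \near +oo%R, (0 : R) <= t by exact: nbhs_pinfty_ge (num_real _).
by apply: filterS => t /max_idPl; rewrite /g => ->.
Qed.

(** * Long-time behaviour *)

Definition bounded_weight (R : realType) (V : finType) (w : R -> weights R V)
    (e : {set V}) : Prop :=
  exists B, forall t, 0 <= t -> w t e <= B.

Definition entropy_flow (R : realType) (V : finType) (adj : rel V) (alpha c : R)
    (w : R -> weights R V) : Prop :=
  forall e, evolves (fun t => w t e) (fun t => entropy_field adj alpha (w t) e) /\
    forall t, 0 <= t -> c <= w t e.

Lemma entropy_flow_positive (R : realType) (V : finType) (adj : rel V) (alpha c : R)
    (w : R -> weights R V) (t : R) :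
  0 < c -> entropy_flow adj alpha c w -> 0 <= t -> positive_weights adj (w t).
Proof.
by move=> c0 wf t0 x y _; apply: lt_le_trans c0 _; exact: (wf _).2.
Qed.

Lemma entropy_flow_nondecreasing (R : realType) (V : finType) (adj : rel V)
    (alpha c : R) (w : R -> weights R V) (e : {set V}) :
  symmetric adj -> irreflexive adj -> 0 < alpha -> alpha < 1 -> 0 < c ->
  entropy_flow adj alpha c w -> nondecreasing_from0 (fun t => w t e).
Proof.
move=> sym irr a0 a1 c0 wf; apply: (evolves_nondecreasing (wf e).1) => t /ltW t0.
rewrite /entropy_field; case: pickP => [[a b]/= /andP[ab _]|//].
apply: edge_entropy_ge0 => //; exact: entropy_flow_positive c0 wf t0.
Qed.

(** If xz were unbounded, its weight would eventually exceed (2 / alpha) B, with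
    B a bound for xy; from then on the entropy of xy is bounded below by a
    positive constant, and integrating it contradicts the bound B. *)
Lemma bounded_weight_adjacent (R : realType) (V : finType) (adj : rel V)
    (alpha c : R) (w : R -> weights R V) (x y z : V) :
  symmetric adj -> irreflexive adj -> 0 < alpha -> alpha < 1 -> 0 < c ->
  entropy_flow adj alpha c w -> adj x y -> adj x z ->
  bounded_weight w [set x; y]%SET -> bounded_weight w [set x; z]%SET.
Proof.
move=> sym irr a0 a1 c0 wf xy xz [B wB]; apply: contrapT => unb.
have [t0 t00 Bt0] : exists2 t, 0 <= t & B / (alpha / 2) < w t [set x; z]%SET.
  apply: contrapT => nex; apply: unb; exists (B / (alpha / 2)) => t t0.
  by rewrite leNgt; apply/negP => lt; apply: nex; exists t.
have ha : 0 < alpha / 2 by lra.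
have d0 : 0 < alpha / 2 * ln 2 by rewrite mulr_gt0// ln_gt0//; lra.
have [|t t00' Bt] := evolves_unbounded (wf [set x; y]%SET).1 t00 d0 _ B.
  move=> t /ltW t0t; have tge0 := le_trans t00 t0t.
  rewrite entropy_field_edge//; apply: (edge_entropy_lower_bound (z := z)) => //.
    exact: entropy_flow_positive c0 wf tge0.
  apply: (le_trans (wB _ tge0)); rewrite mulrC -ler_pdivrMr//.
  apply: (le_trans (ltW Bt0)).
  exact: (entropy_flow_nondecreasing _ sym irr a0 a1 c0 wf).
by have := wB _ t00'; rewrite leNgt Bt.
Qed.

Lemma bounded_weight_connected (R : realType) (V : finType) (adj : rel V)
    (alpha c : R) (w : R -> weights R V) (x y : V) :
  symmetric adj -> irreflexive adj -> connected_graph adj ->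
  0 < alpha -> alpha < 1 -> 0 < c -> entropy_flow adj alpha c w ->
  adj x y -> bounded_weight w [set x; y]%SET ->
  forall a b, adj a b -> bounded_weight w [set a; b]%SET.
Proof.
move=> sym irr conn a0 a1 c0 wf xy bxy a.
(* All edges at a vertex are bounded as soon as one of them is; this spreads
   along a path from x to a. *)
have at_vertex u v : adj u v -> bounded_weight w [set u; v]%SET ->
    forall b, adj u b -> bounded_weight w [set u; b]%SET.
  by move=> uv buv b ub; exact: (bounded_weight_adjacent sym irr a0 a1 c0 wf uv ub).
have /connectP[p] := conn x a.
elim: p x y xy bxy => [|v p ih] x y xy bxy /=; first by move=> _ ->; exact: (at_vertex _ _ xy bxy).
case/andP=> xv pv; apply: (ih v x) => //; first by rewrite sym.
by rewrite finset.setUC; exact: (at_vertex _ _ xy bxy).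
Qed.

(** By continuity the entropies converge to their values at the limit weights;
    a positive value would make the corresponding weight unbounded. *)
Lemma bounded_flow_converges (R : realType) (V : finType) (adj : rel V)
    (alpha c : R) (w : R -> weights R V) :
  symmetric adj -> irreflexive adj -> 0 < alpha -> alpha < 1 -> 0 < c ->
  entropy_flow adj alpha c w ->
  (forall x y, adj x y -> bounded_weight w [set x; y]%SET) ->
  flow_converges adj alpha w.
Proof.
move=> sym irr a0 a1 c0 wf bw.
have nd e := entropy_flow_nondecreasing e sym irr a0 a1 c0 wf.
have ball e : bounded_weight w e.
  have [[p /andP[pp /eqP->]]|ne] := pselect (exists p : V * V,
      adj p.1 p.2 && (e == [set p.1; p.2]%SET)); first exact: bw.
  exists (w 0 e) => t t0.
  have := evolves_le (wf e).1 (evolves_cst (0 : R)) (lexx 0) t0 _.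
  rewrite subrr subr_le0; apply=> s _.
  by rewrite /entropy_field; case: pickP => [p ep|//]; case: ne; exists p.
have /choice[l lP] : forall e, exists l, w t e @[t --> +oo%R] --> l /\
    forall t, 0 <= t -> w t e <= l.
  by move=> e; have [B wB] := ball e; exact: nondecreasing_bounded_cvg (nd e) wB.
have cl e : c <= l e.
  by apply: le_trans ((lP e).2 0 (lexx 0)); exact: (wf e).2.
have [M [M1 lM]] := finite_upper_bound l.
have [C C0 tF] := entropy_field_tame sym irr a0 a1 c0.
have lbox : box c M l by move=> e; rewrite cl lM.
have Fcvg e : entropy_field adj alpha (w t) e @[t --> +oo%R] -->
    entropy_field adj alpha l e.
  apply: (tame_field_cvg (M := M)) tF M1 lbox _ (fun j => (lP j).1).
  have : \forall t \near +oo%R, (0 : R) <= t by exact: nbhs_pinfty_ge (num_real _).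
  apply: filterS => t t0 j; rewrite (wf j).2//=.
  exact: le_trans ((lP j).2 _ t0) (lM j).
have F0 e : entropy_field adj alpha l e = 0.
  apply/eqP; rewrite eq_le; apply/andP; split; last first.
    by case: (tF _ _ e M1 lbox) => /andP[].
  rewrite leNgt; apply/negP => Fpos.
  have hpos : 0 < entropy_field adj alpha l e / 2 by lra.
  have /cvgrPdist_le/(_ _ hpos)[T [_ near_l]] := Fcvg e.
  have T0 : 0 <= Num.max T 0 by rewrite le_max lexx orbT.
  have [t Tt|t t0] := evolves_unbounded (wf e).1 T0 hpos _ (l e).
    have : T < t by apply: le_lt_trans Tt; rewrite le_max lexx.
    by move=> /near_l /=; rewrite ler_norml; lra.
  by rewrite ltNge (lP e).2.
move=> x y xy; split; first exact: nd.
  by exists (l [set x; y]%SET); [exact: lt_le_trans (cl _)|exact: (lP _).1].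
rewrite -(F0 [set x; y]%SET); apply: cvg_trans (Fcvg [set x; y]%SET).
by under eq_fun do rewrite -(entropy_field_edge _ _ xy).
Qed.

Lemma diverges_converges_absurd (R : realType) (V : finType) (adj : rel V)
    (alpha : R) (w : R -> weights R V) :
  (exists x y, adj x y) -> ~ (flow_diverges adj w /\ flow_converges adj alpha w).
Proof.
move=> [x [y xy]] [/(_ x y xy)[_ /cvgryPge dv] /(_ x y xy)[_ [l _ cv] _]].
move/cvgrPdist_le : cv => /(_ 1 ltr01) cv.
have [t] := filter_ex (filterI (dv (l + 2)) cv).
by rewrite /= ler_norml; lra.
Qed.

(** One bounded edge makes all edges bounded; if there is none, monotonicity
    makes every weight diverge. *)
Lemma entropy_flow_dichotomy (R : realType) (V : finType) (adj : rel V)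
    (alpha c : R) (w : R -> weights R V) :
  symmetric adj -> irreflexive adj -> connected_graph adj ->
  0 < alpha -> alpha < 1 -> 0 < c -> entropy_flow adj alpha c w ->
  flow_diverges adj w \/ flow_converges adj alpha w.
Proof.
move=> sym irr conn a0 a1 c0 wf.
have [[x [y [xy bxy]]]|nb] := pselect (exists x y, adj x y /\
    bounded_weight w [set x; y]%SET).
  right; apply: (bounded_flow_converges sym irr a0 a1 c0 wf).
  exact: (bounded_weight_connected sym irr conn a0 a1 c0 wf xy bxy).
left=> x y xy; have nd := entropy_flow_nondecreasing [set x; y]%SET sym irr a0 a1 c0 wf.
split=> //; apply: nondecreasing_unbounded_cvgy => // B.
apply: contrapT => nex; apply: nb; exists x, y; split=> //; exists B => t t0.
by rewrite leNgt; apply/negP => lt; apply: nex; exists t.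
Qed.

(** * Correspondence with solutions of the flow *)

Lemma flow_solution_evolves (R : realType) (V : finType) (adj : rel V) (alpha : R)
    (w0 : weights R V) (w : R -> weights R V) (x y : V) :
  flow_solution adj alpha w0 w -> adj x y ->
  evolves (fun t => edgew (w t) x y) (fun t => edge_entropy adj alpha (w t) x y).
Proof.
by move=> sol xy; have [cw dw _ _] := sol x y xy; split; first exact: (within_continuous_max0 cw).
Qed.

Lemma flow_solution_ge (R : realType) (V : finType) (adj : rel V) (alpha : R)
    (w0 : weights R V) (w : R -> weights R V) (x y : V) (t : R) :
  symmetric adj -> irreflexive adj -> 0 < alpha -> alpha < 1 ->
  flow_solution adj alpha w0 w -> adj x y -> 0 <= t ->
  edgew w0 x y <= edgew (w t) x y.
Proof.
move=> sym irr a0 a1 sol xy t0; have [_ _ _ <-] := sol x y xy.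
apply: (evolves_nondecreasing (flow_solution_evolves sol xy)) => // s s0.
by apply: edge_entropy_ge0 => // u v uv; have [_ _ + _] := sol u v uv; apply.
Qed.

Lemma entropy_flow_solution (R : realType) (V : finType) (adj : rel V) (alpha c : R)
    (w0 : weights R V) (w : R -> weights R V) :
  0 < c -> entropy_flow adj alpha c w ->
  (forall x y, adj x y -> edgew (w 0) x y = edgew w0 x y) ->
  flow_solution adj alpha w0 w.
Proof.
move=> c0 wf w00 x y xy; have [Hw cw] := wf [set x; y]%SET; split.
- exact: evolves_within_continuous Hw.
- by move=> t t0; rewrite -entropy_field_edge//; exact: Hw.2.
- by move=> t t0; apply: lt_le_trans c0 (cw _ (ltW t0)).
- exact: w00.
Qed.

Lemma flow_solution_unique (R : realType) (V : finType) (adj : rel V) (alpha c : R)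
    (w0 : weights R V) (w w' : R -> weights R V) (x y : V) (t : R) :
  symmetric adj -> irreflexive adj -> 0 < alpha -> alpha < 1 -> 0 < c ->
  (forall x y, adj x y -> c <= edgew w0 x y) ->
  entropy_flow adj alpha c w ->
  (forall x y, adj x y -> edgew (w 0) x y = edgew w0 x y) ->
  flow_solution adj alpha w0 w' -> 0 <= t -> adj x y ->
  edgew (w' t) x y = edgew (w t) x y.
Proof.
move=> sym irr a0 a1 c0 cw0 wf w00 sol t0 xy.
have [C C0 tF] := entropy_field_tame sym irr a0 a1 c0.
pose isedge (e : {set V}) :=
  [exists p : V * V, adj p.1 p.2 && (e == [set p.1; p.2]%SET)].
have isedge2 a b : adj a b -> isedge [set a; b]%SET.
  by move=> ab; apply/existsP; exists (a, b); rewrite /= ab eqxx.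
(* Off the edges w' is arbitrary, so it is replaced there by w. *)
pose v (e : {set V}) (s : R) := if isedge e then w' s e else w s e.
have v_edge s a b : adj a b -> edgew (v^~ s) a b = edgew (w' s) a b.
  by move=> /isedge2 ab; rewrite /edgew /v ab.
have field_v s e : entropy_field adj alpha (v^~ s) e = entropy_field adj alpha (w' s) e.
  rewrite /entropy_field; case: pickP => [[a b]/= /andP[ab _]|//].
  by apply: edge_entropy_ext => // ? ?; exact: v_edge.
suff <- : v [set x; y]%SET t = edgew (w t) x y by rewrite /v isedge2.
apply: (tame_field_unique (v := fun e s => w s e) c0 tF) => //.
- move=> e; under [X in evolves _ X]eq_fun do rewrite field_v.
  rewrite /v; have [/existsP[[a b]/= /andP[ab /eqP->]]|ne] := boolP (isedge e).
    under [X in evolves _ X]eq_fun do rewrite entropy_field_edge//.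
    exact: flow_solution_evolves sol ab.
  suff -> : (fun s => entropy_field adj alpha (w' s) e) =
            (fun s => entropy_field adj alpha (w s) e) by exact: (wf e).1.
  apply/funext => s; rewrite /entropy_field; case: pickP => [p ep|//].
  by case/existsP: ne; exists p.
- by move=> e; exact: (wf e).1.
- move=> e s s0; rewrite /v; case: ifP => [/existsP[[a b]/= /andP[ab /eqP->]]|_].
    exact: le_trans (cw0 _ _ ab) (flow_solution_ge sym irr a0 a1 sol ab s0).
  exact: (wf e).2.
- by move=> e s; exact: (wf e).2.
- move=> e; rewrite /v; case: ifP => [/existsP[[a b]/= /andP[ab /eqP->]]|//].
  by have [_ _ _ w'0] := sol a b ab; rewrite -[LHS]/(edgew (w' 0) a b) w'0 -w00.
Qed.

Theorem theorem2p1 (R : realType) (V : finType) (adj : rel V)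
    (adj_simple : simple_graph adj) (adj_connected : connected_graph adj)
    (has_edge : exists x y : V, adj x y)
    (w0 : weights R V) (w0_gt0 : positive_weights adj w0)
    (alpha : R) (alpha_gt0 : 0 < alpha) (alpha_lt1 : alpha < 1) :
  exists w : R -> weights R V,
    [/\ flow_solution adj alpha w0 w,
        (forall t : R, 0 <= t -> positive_weights adj (w t)),
        (forall w' : R -> weights R V, flow_solution adj alpha w0 w' ->
           forall t : R, 0 <= t -> forall x y : V, adj x y ->
             edgew (w' t) x y = edgew (w t) x y)
      & (flow_diverges adj w \/ flow_converges adj alpha w) /\
        ~ (flow_diverges adj w /\ flow_converges adj alpha w)].
Proof.
have [sym irr] := adj_simple.
(* Only edge weights are known to be positive; elsewhere the initial datum is
   made positive, which does not affect the flow on edges. *)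
pose v0 (e : {set V}) := if 0 < w0 e then w0 e else 1.
have v0_gt0 e : 0 < v0 e by rewrite /v0; case: ifP.
have v0_edge x y : adj x y -> edgew v0 x y = edgew w0 x y.
  by move=> xy; have := w0_gt0 _ _ xy; rewrite /edgew /v0 => ->.
have [M [M1 v0M]] := finite_upper_bound (fun e => (v0 e)^-1).
pose c := M^-1; have c0 : 0 < c by rewrite invr_gt0; lra.
have cv0 e : c <= v0 e.
  by rewrite -[v0 e]invrK lef_pV2 ?posrE ?invr_gt0//; lra.
have [C C0 tF] := entropy_field_tame sym irr alpha_gt0 alpha_lt1 c0.
have [u uP] := tame_field_global_solution c0 C0 tF cv0.
pose w (t : R) : weights R V := u^~ t.
have wf : entropy_flow adj alpha c w by move=> e; have [_ ? ?] := uP e.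
have w00 x y : adj x y -> edgew (w 0) x y = edgew w0 x y.
  by move=> xy; rewrite -v0_edge// /edgew /w; have [-> _ _] := uP [set x; y]%SET.
exists w; split.
- exact: entropy_flow_solution c0 wf w00.
- by move=> t; exact: entropy_flow_positive c0 wf.
- move=> w' sol t t0 x y xy.
  apply: (flow_solution_unique sym irr alpha_gt0 alpha_lt1 c0 _ wf w00 sol t0 xy).
  by move=> a b ab; rewrite -v0_edge//; exact: cv0.
- split; first exact: entropy_flow_dichotomy wf.
  exact: diverges_converges_absurd.
Qed.
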